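(* For any integer $\ell\geq 5$ there exists a graph $G$ with a vertex $v$ such that $\gamma_g(G)=\ell$ and $\gamma_g(G-v)=\ell-2$.
   Context: Graphs are finite, simple and undirected. A vertex dominates itself and all its neighbors. The domination game on a graph $G$ is played by two players, Dominator and Staller, who alternately choose a vertex of $G$ such that each chosen vertex dominates at least one vertex that was not dominated by the previously chosen vertices. The game ends when all vertices of $G$ are dominated. Dominator wants the total number of chosen vertices to be as small as possible, Staller wants it to be as large as possible. Assuming both play optimally, $\gamma_g(G)$ (the game domination number) is the total number of vertices chosen when Dominator moves first. $G-v$ denotes the graph obtained from $G$ by removing the vertex $v$ and all edges incident with it. *)

(* Defs.v *)
From mathcomp Require Import all_boot.

Set Implicit Arguments.
Unset Strict Implicit.
Unset Printing Implicit Defensive.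

Record sgraph := SGraph {
  vertex :> finType;
  adj : rel vertex;
  adj_sym : symmetric adj;
  adj_irrefl : irreflexive adj
}.

Section DeleteVertex.
Variables (G : sgraph) (v : G).

Definition del_adj : rel {u : G | u != v} := fun x y => adj (val x) (val y).

Lemma del_adj_sym : symmetric del_adj.
Proof. by move=> x y; exact: adj_sym. Qed.

Lemma del_adj_irrefl : irreflexive del_adj.
Proof. by move=> x; exact: adj_irrefl. Qed.

Definition del_vertex : sgraph := SGraph del_adj_sym del_adj_irrefl.

End DeleteVertex.

Inductive player := Dominator | Staller.

Definition opponent (p : player) : player :=
  match p with Dominator => Staller | Staller => Dominator end.

Section DominationGame.
Variable G : sgraph.
Implicit Types (S : {set G}) (u w : G) (p : player) (n : nat).

Definition dominates w u : bool := (u == w) || adj w u.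

Definition dominated S : {set G} := [set u | [exists w in S, dominates w u]].

Definition game_over S : bool := dominated S == [set: G].

Definition legal S w : bool :=
  [exists u, dominates w u && (u \notin dominated S)].

(* The number of moves still to be made under optimal play when the vertices
   of S have been chosen and p is to move.  The first argument is fuel: a move
   dominates a new vertex, so any fuel n >= #|~: dominated S| gives the same
   value (game_length_stable); game_value_over, game_value_Staller and
   game_value_Dominator are the resulting fuel-free minimax equations.  The
   default value of the minimum is harmless: with fuel n the values do not
   exceed n, and an unfinished game has a legal move (game_length_le,
   legal_exists). *)
Fixpoint game_length (n : nat) (p : player) (S : {set G}) : nat :=
  if n is n'.+1 then
    if game_over S then 0
    else match p with
    | Dominator =>
        (\big[minn/n']_(w | legal S w) game_length n' Staller (w |: S)).+1
    | Staller =>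
        (\max_(w | legal S w) game_length n' Dominator (w |: S)).+1
    end
  else 0.

Definition game_value p S : nat := game_length #|G| p S.

Definition game_domination_number : nat := game_value Dominator set0.

Lemma legal_exists S : ~~ game_over S -> exists w, legal S w.
Proof.
rewrite /game_over eqEsubset subsetT /= => /subsetPn [u _ Hu].
by exists u; apply/existsP; exists u; rewrite /dominates eqxx Hu.
Qed.

Lemma game_lengthS n p S : ~~ game_over S ->
  game_length n.+1 p S = (match p with
    | Dominator => \big[minn/n]_(w | legal S w) game_length n Staller (w |: S)
    | Staller => \max_(w | legal S w) game_length n Dominator (w |: S)
    end).+1.
Proof. by rewrite /= => /negPf ->; case: p. Qed.

Lemma game_length_le n p S : game_length n p S <= n.
Proof.
elim: n p S => [|n IHn] p S //=; case: ifP => // Hover; case: p; rewrite ltnS.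
  by elim/big_rec: _ => // w x _ Hx; rewrite geq_min Hx orbT.
by apply/bigmax_leqP => w _; exact: IHn.
Qed.

Lemma dominatedU1 S w : dominated S \subset dominated (w |: S).
Proof.
apply/subsetP => u; rewrite !inE => /existsP [x /andP [xS xu]].
by apply/existsP; exists x; rewrite !inE xS orbT.
Qed.

Lemma legal_undominated S w :
  legal S w -> #|~: dominated (w |: S)| < #|~: dominated S|.
Proof.
case/existsP => u /andP [wu uS]; apply: proper_card.
rewrite properE setCS dominatedU1 /=; apply/subsetPn; exists u.
  by rewrite inE.
rewrite !inE negbK; apply/existsP; exists w.
by rewrite !inE eqxx wu.
Qed.

Lemma bigmin_default (P : pred G) (F : G -> nat) m m' :
  (exists w, P w) -> (forall w, F w <= m) -> m <= m' ->
  \big[minn/m]_(w | P w) F w = \big[minn/m']_(w | P w) F w.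
Proof.
move=> [w Pw] Fm mm'.
have -> : \big[minn/m]_(w | P w) F w = minn (\big[minn/m']_(w | P w) F w) m.
  elim/big_rec2: _ => [|x a b _ ->]; first by apply/esym/minn_idPr.
  by rewrite minnA.
apply/minn_idPl; apply: leq_trans (Fm w).
have: w \in index_enum G by rewrite mem_index_enum.
elim: (index_enum G) => // x r IHr; rewrite inE big_cons.
case/orP => [/eqP <-|/IHr le_w]; first by rewrite Pw geq_minl.
by case: ifP => // _; rewrite geq_min le_w orbT.
Qed.

Lemma game_over_undominated S : (#|~: dominated S| == 0) = game_over S.
Proof. by rewrite cards_eq0 -(inj_eq (@setC_inj _)) setCK setC0. Qed.

Lemma game_length_stable n p S :
  #|~: dominated S| <= n -> game_length n p S = game_length #|~: dominated S| p S.
Proof.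
have step : forall n p S, #|~: dominated S| <= n ->
    game_length n.+1 p S = game_length n p S.
  elim=> [|{}n IHn] {}p {}S.
    by rewrite leqn0 game_over_undominated /= => ->.
  move=> Hn; have [over|HS] := boolP (game_over S); first by rewrite /= over.
  have IH q w : legal S w ->
      game_length n.+1 q (w |: S) = game_length n q (w |: S).
    by move=> /legal_undominated lt_w; apply: IHn; rewrite -ltnS (leq_trans lt_w).
  rewrite !game_lengthS //; congr _.+1.
  case: p; last by apply: eq_bigr => w /IH.
  under eq_bigr => w Hw do rewrite IH //.
  apply/esym/bigmin_default => //; first exact: legal_exists.
  by move=> w; exact: game_length_le.
elim: n => [|n IHn] Hn; first by move: Hn; rewrite leqn0 => /eqP ->.
move: Hn; rewrite leq_eqVlt => /orP [/eqP -> //|]; rewrite ltnS => Hn.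
by rewrite step // IHn.
Qed.

Lemma game_value_fuel n p S :
  #|~: dominated S| <= n -> game_value p S = game_length n p S.
Proof.
by move=> Hn; rewrite /game_value game_length_stable ?max_card // [RHS]game_length_stable.
Qed.

Lemma game_value_over p S : game_over S -> game_value p S = 0.
Proof. by rewrite /game_value; case: #|_| => //= n ->. Qed.

Lemma game_value_Staller S : ~~ game_over S ->
  game_value Staller S =
  (\max_(w | legal S w) game_value Dominator (w |: S)).+1.
Proof.
move=> HS; rewrite (@game_value_fuel #|G|.+1) ?game_lengthS //.
exact: leq_trans (max_card _) (leqnSn _).
Qed.

Lemma game_value_Dominator S : ~~ game_over S ->
  game_value Dominator S =
  (\big[minn/#|G|]_(w | legal S w) game_value Staller (w |: S)).+1.
Proof.
move=> HS; rewrite (@game_value_fuel #|G|.+1) ?game_lengthS //.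
exact: leq_trans (max_card _) (leqnSn _).
Qed.

End DominationGame.

(* Main.v *)
(** Adding two isolated vertices to a graph raises its game domination number
    by exactly 2: whichever player profits can answer a move on one of them by a
    move on the other.  Hence examples for [l] give examples for [l + 2], and
    only [l = 5] and [l = 6] remain.  Take the 9-vertex tree in which a root [0]
    has two pendant paths 0-1-2 and 0-3-4 and a third branch 0-5-6 whose end 6
    carries two leaves 7 and 8, together with one isolated vertex if [l = 6];
    removing the root lowers the game domination number by 2, as an
    evaluation of the game tree shows. *)

Require Import Defs.
From mathcomp Require Import all_boot.

Set Implicit Arguments.
Unset Strict Implicit.
Unset Printing Implicit Defensive.

(** * Auxiliary facts on minima and on enumerations of subtypes *)

Lemma bigminn_leq (I : finType) (P : pred I) (F : I -> nat) m i :
  P i -> \big[minn/m]_(j | P j) F j <= F i.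
Proof.
move=> Pi; have : i \in index_enum I by rewrite mem_index_enum.
elim: (index_enum I) => // j r IHr; rewrite inE big_cons.
case/orP => [/eqP <-|/IHr le_i]; first by rewrite Pi geq_minl.
by case: ifP => // _; rewrite geq_min le_i orbT.
Qed.

(** Needed to list the vertices of a vertex-deleted graph explicitly before evaluating its game. *)
Lemma val_enum_sig (T : finType) (P : pred T) :
  map val (enum {: {x | P x}}) = [seq x <- enum T | P x].
Proof.
have -> : enum {: {x | P x}} = pmap insub (enum T).
  by rewrite [in LHS]enumT [in LHS]unlock [in RHS]enumT.
rewrite pmap_filter; last exact: insubK.
by apply: eq_filter => x; exact: isSome_insub.
Qed.

(** * Optimal moves, treated uniformly for both players *)

Section OptimalMoves.
Variable G : sgraph.
Implicit Types (S : {set G}) (u w : G) (p : player).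

(** Preference order of [p] on game lengths; with it one argument covers both players. *)
Definition better p m n := if p is Dominator then m <= n else n <= m.

Lemma better_anti p m n : better p m n -> better p n m -> m = n.
Proof. by case: p => /= le1 le2; apply/eqP; rewrite eqn_leq le1 le2. Qed.

Lemma better_trans p m n k : better p m n -> better p n k -> better p m k.
Proof.
case: p => /= [|le1 le2]; first exact: leq_trans.
exact: leq_trans le2 le1.
Qed.

Lemma opponentK p : opponent (opponent p) = p.
Proof. by case: p. Qed.

Lemma better_opponent p m n : better (opponent p) m n = better p n m.
Proof. by case: p. Qed.

Lemma betterS p m n : better p m.+1 n.+1 = better p m n.
Proof. by case: p. Qed.

Lemma better_refl p m : better p m m.
Proof. by case: p => /=. Qed.

Lemma mem_dominatedU1 S w u :
  (u \in dominated (w |: S)) = dominates w u || (u \in dominated S).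
Proof.
rewrite !inE; apply/existsP/orP => [[x]|].
  rewrite !inE; case/andP=> /orP [/eqP -> ->|xS xu]; first by left.
  by right; apply/existsP; exists x; rewrite xS.
case=> [wu|/existsP [x /andP [xS xu]]]; first by exists w; rewrite !inE eqxx.
by exists x; rewrite !inE xS orbT.
Qed.

Lemma mem_dominated0 u : (u \in dominated (set0 : {set G})) = false.
Proof. by rewrite inE; apply/existsP => -[x]; rewrite inE. Qed.

Lemma legalP S w :
  reflect (exists2 u, dominates w u & u \notin dominated S) (legal S w).
Proof.
by apply: (iffP existsP) => [[u /andP [wu uS]]|[u wu uS]]; exists u; rewrite ?wu.
Qed.

Lemma legal_not_over S w : legal S w -> ~~ game_over S.
Proof.
by case/legalP => u _; apply: contra => /eqP ->; rewrite inE.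
Qed.

Lemma value_move p S w : legal S w ->
  better p (game_value p S) (game_value (opponent p) (w |: S)).+1.
Proof.
move=> Hw; have HS := legal_not_over Hw; case: p => /=.
  rewrite game_value_Dominator // ltnS.
  exact: (bigminn_leq (fun w => game_value Staller (w |: S))).
rewrite game_value_Staller // ltnS.
exact: (@leq_bigmax_cond _ _ (fun w => game_value Dominator (w |: S))).
Qed.

Lemma value_best p S : ~~ game_over S ->
  exists2 w, legal S w & game_value p S = (game_value (opponent p) (w |: S)).+1.
Proof.
move=> HS; have [w0 Hw0] := legal_exists HS; case: p => /=.
  rewrite game_value_Dominator //.
  case: (@arg_minnP _ w0 (legal S) (fun w => game_value Staller (w |: S)) Hw0).
  move=> w Hw min_w; exists w => //; congr _.+1; apply/eqP; rewrite eqn_leq.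
  have /= := value_move Dominator Hw; rewrite game_value_Dominator // ltnS => -> /=.
  (* The default [#|G|] of the minimum is harmless: no game value exceeds the fuel [#|G|]. *)
  elim/big_rec: _ => [|x m Hx le_m]; first exact: game_length_le.
  by rewrite leq_min le_m min_w.
rewrite game_value_Staller //.
have [|w Hw ->] := @eq_bigmax_cond _ (legal S) (fun w => game_value Dominator (w |: S)).
  by apply/card_gt0P; exists w0.
by exists w.
Qed.

End OptimalMoves.

(** * The effect of two isolated vertices on the game value *)

Section TwoIsolatedVertices.
Variables (G H : sgraph) (f : G -> H) (a b : H).
Hypotheses (f_inj : injective f)
  (f_adj : forall x y, adj (f x) (f y) = adj x y)
  (f_neq_a : forall x, f x != a) (f_neq_b : forall x, f x != b)
  (neq_ab : a != b)
  (a_isolated : forall y, adj a y = false)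
  (b_isolated : forall y, adj b y = false)
  (f_cover : forall y, [\/ exists x, y = f x, y = a | y = b]).
Implicit Types (S : {set G}) (T : {set H}).

(** Positions are compared through what they dominate in [G], not through the chosen vertices, so
    moves on [a] and [b] do not disturb the relation. *)
Let agree S T := forall x, (f x \in dominated T) = (x \in dominated S).

Let f_dominates x y : dominates (f x) (f y) = dominates x y.
Proof. by rewrite /dominates f_adj (inj_eq f_inj). Qed.

Let a_dominates y : dominates a y = (y == a).
Proof. by rewrite /dominates a_isolated orbF. Qed.

Let b_dominates y : dominates b y = (y == b).
Proof. by rewrite /dominates b_isolated orbF. Qed.

Let f_dominates_a x : dominates (f x) a = false.
Proof. by rewrite /dominates adj_sym a_isolated orbF eq_sym (negPf (f_neq_a x)). Qed.

Let f_dominates_b x : dominates (f x) b = false.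
Proof. by rewrite /dominates adj_sym b_isolated orbF eq_sym (negPf (f_neq_b x)). Qed.

Let agree_f S T x : agree S T -> agree (x |: S) (f x |: T).
Proof. by move=> ST y; rewrite !mem_dominatedU1 f_dominates ST. Qed.

Let agree_a S T : agree S T -> agree S (a |: T).
Proof.
by move=> ST y; rewrite mem_dominatedU1 a_dominates (negPf (f_neq_a y)) ST.
Qed.

Let agree_b S T : agree S T -> agree S (b |: T).
Proof.
by move=> ST y; rewrite mem_dominatedU1 b_dominates (negPf (f_neq_b y)) ST.
Qed.

Let legal_f S T x : agree S T -> legal T (f x) = legal S x.
Proof.
move=> ST; apply/legalP/legalP => [[y]|[y xy yS]]; last first.
  by exists (f y); rewrite ?f_dominates ?ST.
have [[z ->]|->|->] := f_cover y; last 2 first.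
- by rewrite f_dominates_a.
- by rewrite f_dominates_b.
by rewrite f_dominates ST => xz zS; exists z.
Qed.

Let legal_a T : legal T a = (a \notin dominated T).
Proof.
apply/legalP/idP => [[y]|aT]; first by rewrite a_dominates => /eqP ->.
by exists a; rewrite ?a_dominates.
Qed.

Let legal_b T : legal T b = (b \notin dominated T).
Proof.
apply/legalP/idP => [[y]|bT]; first by rewrite b_dominates => /eqP ->.
by exists b; rewrite ?b_dominates.
Qed.

(** Induction on the number of undominated vertices of [H]: moves inside [G] are mirrored between
    the two games, and the pair [a], [b] costs two moves, which leave the same player to move. *)
Lemma game_value_two_isolated p S T : agree S T ->
  (a \in dominated T) = (b \in dominated T) ->
  game_value p T = game_value p S + (a \notin dominated T).*2.
Proof.
have [n] := ubnP #|~: dominated T|.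
elim: n => // n IHn in p S T *; rewrite ltnS => leTn ST eq_ab.
(* The inclusion lets the induction hypothesis apply after one move as well as after two. *)
have IH q w S' T' : legal T w -> dominated (w |: T) \subset dominated T' ->
    agree S' T' -> (a \in dominated T') = (b \in dominated T') ->
    game_value q T' = game_value q S' + (a \notin dominated T').*2.
  move=> Hw subT'; apply: IHn.
  apply: leq_ltn_trans (leq_trans (legal_undominated Hw) leTn).
  by apply: subset_leq_card; rewrite setCS.
have IHf x : legal S x ->
    game_value (opponent p) (f x |: T) =
      game_value (opponent p) (x |: S) + (a \notin dominated T).*2.
  move=> Hx; rewrite (IH _ (f x) (x |: S)) ?(legal_f _ ST) //.
  - by rewrite mem_dominatedU1 f_dominates_a.
  - exact: agree_f.
  - by rewrite !mem_dominatedU1 f_dominates_a f_dominates_b.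
have IHab : a \notin dominated T ->
    game_value p (b |: (a |: T)) = game_value p S
    /\ game_value p (a |: (b |: T)) = game_value p S.
  move=> aT; have bT : b \notin dominated T by rewrite -eq_ab.
  have dom_ab : (a \in dominated (b |: (a |: T)))
             && (b \in dominated (b |: (a |: T)))
    by rewrite !mem_dominatedU1 !a_dominates !b_dominates !eqxx !orbT.
  have dom_ba : (a \in dominated (a |: (b |: T)))
             && (b \in dominated (a |: (b |: T)))
    by rewrite !mem_dominatedU1 !a_dominates !b_dominates !eqxx !orbT.
  case/andP: dom_ab => aab bab; case/andP: dom_ba => aba bba; split.
    rewrite (IH _ a S) ?legal_a ?dominatedU1 ?aab ?bab ?addn0 //.
    exact/agree_b/agree_a.
  rewrite (IH _ b S) ?legal_b ?dominatedU1 ?aba ?bba ?addn0 //.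
  exact/agree_a/agree_b.
(* A move on one isolated vertex is answered by a move on the other one. *)
have reply : a \notin dominated T ->
       better p (game_value p S + 2) (game_value (opponent p) (a |: T)).+1
    /\ better p (game_value p S + 2) (game_value (opponent p) (b |: T)).+1.
  move=> aT; have bT : b \notin dominated T by rewrite -eq_ab.
  have [Vba Vab] := IHab aT; rewrite addn2 !betterS.
  rewrite -!(better_opponent p) -{1}Vba -{1}Vab; split.
    rewrite -[X in game_value X (b |: _)]opponentK; apply: value_move.
    by rewrite legal_b mem_dominatedU1 a_dominates eq_sym (negPf neq_ab).
  rewrite -[X in game_value X (a |: _)]opponentK; apply: value_move.
  by rewrite legal_a mem_dominatedU1 b_dominates (negPf neq_ab).
apply: (@better_anti p).
  (* First, [p] does at least as well as claimed, by copying an optimal move of [G] while there is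
     one. *)
  have [overS|HS] := boolP (game_over S); last first.
    have [x Hx ->] := value_best p HS.
    by rewrite addSn -IHf //; apply: value_move; rewrite (legal_f _ ST).
  have [aT|aT] := boolP (a \in dominated T).
    rewrite game_value_over ?game_value_over //; first exact: better_refl.
    apply/eqP/setP => y; rewrite [RHS]inE.
    have [[z ->]|->|->] := f_cover y; rewrite -?eq_ab ?aT //.
    by rewrite ST (eqP overS) inE.
  (* Only [a] and [b] are undominated here: [p] takes [a], and the opponent is then forced to take
     [b]. *)
  apply: (better_trans (value_move p (_ : legal T a))); first by rewrite legal_a.
  rewrite addn2 betterS.
  have baT : b \notin dominated (a |: T).
    rewrite mem_dominatedU1 a_dominates eq_sym (negPf neq_ab) -eq_ab //.
  have [|w Hw ->] := @value_best _ (opponent p) (a |: T).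
    by apply: (@legal_not_over _ _ b); rewrite legal_b.
  suff -> : w = b by rewrite opponentK (IHab aT).1; exact: better_refl.
  have [[z defw]|defw|//] := f_cover w; move: Hw; rewrite defw.
    rewrite (legal_f z (agree_a ST)) => /legal_not_over.
    by rewrite overS.
  by rewrite legal_a mem_dominatedU1 a_dominates eqxx.
(* Conversely, [p] does no better: an optimal move [f x] can be copied in [G], and one on [a] or [b]
   is met by [reply]. *)
have [overT|HT] := boolP (game_over T).
  rewrite !game_value_over // ?(eqP overT) ?inE; first exact: better_refl.
  by apply/eqP/setP => x; rewrite -ST (eqP overT) !inE.
have [w Hw ->] := value_best p HT.
have [[x defw]|defw|defw] := f_cover w; move: Hw; rewrite defw.
- rewrite (legal_f _ ST) => Hx; rewrite IHf // -addSn.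
  have := value_move p Hx; case: p {IHf IHab reply} => /=; rewrite leq_add2r //.
- by rewrite legal_a => aT; rewrite aT; case: (reply aT).
- by rewrite legal_b -eq_ab => aT; rewrite aT; case: (reply aT).
Qed.

Lemma game_domination_number_two_isolated :
  game_domination_number H = game_domination_number G + 2.
Proof.
rewrite /game_domination_number (@game_value_two_isolated _ set0).
- by rewrite mem_dominated0.
- by move=> x; rewrite !mem_dominated0.
- by rewrite !mem_dominated0.
Qed.

End TwoIsolatedVertices.

(** * Extending a graph by two isolated vertices *)

Section AddTwoIsolatedVertices.
Variable G : sgraph.

Definition add2_adj : rel (G + bool)%type := fun x y =>
  match x, y with inl x', inl y' => adj x' y' | _, _ => false end.

Lemma add2_adj_sym : symmetric add2_adj.
Proof. by move=> [x|?] [y|?] //=; exact: adj_sym. Qed.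

Lemma add2_adj_irrefl : irreflexive add2_adj.
Proof. by move=> [x|?] //=; exact: adj_irrefl. Qed.

Definition add2 : sgraph := SGraph add2_adj_sym add2_adj_irrefl.

Lemma game_domination_number_add2 :
  game_domination_number add2 = game_domination_number G + 2.
Proof.
apply: (@game_domination_number_two_isolated G add2 inl (inr true) (inr false)).
all: try by [].
- by move=> x y [].
- by move=> [x|[]]; [apply: Or31; exists x | apply: Or32 | apply: Or33].
Qed.

(** Deleting a vertex of [G] commutes with adding the isolated pair, up to the embedding [emb]. *)
Lemma game_domination_number_del_add2 (v : G) :
  game_domination_number (@del_vertex add2 (inl v)) =
  game_domination_number (del_vertex v) + 2.
Proof.
pose emb (x : del_vertex v) : @del_vertex add2 (inl v) :=
  exist (fun u : add2 => u != inl v) (inl (val x)) (valP x).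
pose iso c : @del_vertex add2 (inl v) :=
  exist (fun u : add2 => u != inl v) (inr c) isT.
apply: (@game_domination_number_two_isolated _ _ emb (iso true) (iso false)).
all: try by [].
- by move=> x y [/val_inj].
- move=> [[x|[]] Hx]; [apply: Or31 | apply: Or32 | apply: Or33].
  + by exists (exist (fun u : G => u != v) x Hx); apply: val_inj.
  + exact: val_inj.
  + exact: val_inj.
Qed.

End AddTwoIsolatedVertices.

(** * Evaluating the game on lists of labels *)

Section Computation.

(* Vertices are labelled by numbers: [d] is the domination relation, [e] lists
   all vertices, and [U] those still undominated. *)
Fixpoint seq_value (d : rel nat) (e : seq nat) n p (U : seq nat) : nat :=
  if n is n'.+1 then
    if nilp U then 0
    else
      let moves := [seq w <- e | has (d w) U] in
      let values :=
        [seq seq_value d e n' (opponent p) [seq u <- U | ~~ d w u] | w <- moves] in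
      (if p is Dominator then foldr minn n' values else foldr maxn 0 values).+1
  else 0.

Variables (G : sgraph) (f : G -> nat) (d : rel nat).
Hypothesis fd : forall x y, d (f x) (f y) = dominates x y.

Let undominated (S : {set G}) := [seq f x | x <- enum G & x \notin dominated S].

Let has_undominated S w : has (d (f w)) (undominated S) = legal S w.
Proof.
apply/hasP/legalP => [[_ /mapP [u] + ->]|[u wu uS]].
  by rewrite mem_filter fd => /andP [uS _] wu; exists u.
by exists (f u); rewrite ?fd //; apply: map_f; rewrite mem_filter uS mem_enum.
Qed.

Let undominatedU1 S w :
  [seq u <- undominated S | ~~ d (f w) u] = undominated (w |: S).
Proof.
rewrite /undominated filter_map -filter_predI; congr map.
by apply: eq_filter => u /=; rewrite fd mem_dominatedU1 negb_or.
Qed.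

Let nilp_undominated S : nilp (undominated S) = game_over S.
Proof.
rewrite /nilp size_map -all_pred0 all_filter; apply/allP/eqP => [all0|-> u _].
  apply/setP => u; rewrite [RHS]inE.
  by have := all0 u; rewrite mem_enum /= implybF negbK => ->.
by rewrite /= !inE.
Qed.

(** Both recursions use the same fuel and the same defaults [n'] and 0 for minimum and maximum, so
    they agree step by step for every [n]. This moves the game to number lists, where it can be
    evaluated. *)
Lemma game_length_seq n p S :
  game_length n p S = seq_value d (map f (enum G)) n p (undominated S).
Proof.
elim: n p S => //= n IHn p S; rewrite nilp_undominated; case: ifP => // _.
have -> : [seq w <- map f (enum G) | has (d w) (undominated S)] =
          map f [seq w <- enum G | legal S w].
  by rewrite filter_map; congr map; apply: eq_filter => w /=; exact: has_undominated.
rewrite -map_comp; case: p; rewrite foldrE big_map big_filter [index_enum _]unlock -enumT.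
  by congr _.+1; apply: eq_bigr => w _; rewrite /= undominatedU1 IHn.
by congr _.+1; apply: eq_bigr => w _; rewrite /= undominatedU1 IHn.
Qed.

Lemma game_domination_number_seq :
  let e := map f (enum G) in
  game_domination_number G = seq_value d e (size e) Dominator e.
Proof.
rewrite /= /game_domination_number /game_value game_length_seq size_map -cardE.
congr (seq_value _ _ _ _ (map f _)); apply/all_filterP/allP => x _.
by rewrite mem_dominated0.
Qed.

End Computation.

(** * The base examples and the conclusion *)

Definition tree_edges : seq (nat * nat) :=
  [:: (0, 1); (0, 3); (0, 5); (1, 2); (3, 4); (5, 6); (6, 7); (6, 8)].

Definition tree_adj : rel nat := fun i j =>
  ((i, j) \in tree_edges) || ((j, i) \in tree_edges).

Definition tree_dominates : rel nat := fun i j => (j == i) || tree_adj i j.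

Section Forest.
Variable n : nat.

(* The tree is the case [n = 9]; vertices from 9 on are isolated. *)
Definition forest_adj : rel 'I_n := fun i j => tree_adj i j.

Lemma forest_adj_sym : symmetric forest_adj.
Proof. by move=> i j; rewrite /forest_adj /tree_adj orbC. Qed.

Lemma forest_adj_irrefl : irreflexive forest_adj.
Proof.
move=> i; rewrite /forest_adj /tree_adj orbb; apply/negP.
by have/allP/[apply] : all (fun e => e.1 != e.2) tree_edges by []; rewrite eqxx.
Qed.

Definition forest : sgraph := SGraph forest_adj_sym forest_adj_irrefl.

Lemma game_domination_number_forest :
  game_domination_number forest =
  seq_value tree_dominates (iota 0 n) n Dominator (iota 0 n).
Proof.
rewrite (@game_domination_number_seq forest val tree_dominates) //.
by rewrite val_enum_ord size_iota.
Qed.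

(** The remaining vertices keep their labels through [val \o val], so the same [tree_dominates]
    serves. *)
Lemma game_domination_number_del_forest (v : forest) :
  let e := [seq i <- iota 0 n | i != val v] in
  game_domination_number (del_vertex v) =
  seq_value tree_dominates e (size e) Dominator e.
Proof.
rewrite (@game_domination_number_seq (del_vertex v) (val \o val) tree_dominates) //.
by rewrite map_comp val_enum_sig -val_enum_ord filter_map.
Qed.

End Forest.

Theorem proposition3p2 (l : nat) (hl : 5 <= l) :
  exists (G : sgraph) (v : G),
    game_domination_number G = l /\
    game_domination_number (del_vertex v) = l - 2.
Proof.
(* Strong induction, since the step goes from [l - 2] to [l]; it needs [5 <= l - 2], which leaves 5
   and 6 as base cases. *)
have [n] := ubnP l; elim: n => // n IHn in l hl *; rewrite ltnS => le_ln.
have [lt7|le7] := ltnP l 7.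
  have [-> | ->] : l = 5 \/ l = 6 by case: l lt7 hl {le_ln} => [|[|[|[|[|[|[|]]]]]]]; auto.
    exists (forest 9), (ord0 : 'I_9).
    rewrite game_domination_number_forest game_domination_number_del_forest.
    by split; vm_compute.
  exists (forest 10), (ord0 : 'I_10).
  rewrite game_domination_number_forest game_domination_number_del_forest.
  by split; vm_compute.
have [||G [v [VG VGv]]] := IHn (l - 2).
- by rewrite leq_subRL // (leq_trans _ le7).
- by case: l le7 le_ln {hl} => [|[]] //= l _; rewrite subn2; apply: leq_trans.
exists (add2 G), (inl v).
rewrite game_domination_number_add2 game_domination_number_del_add2 VG VGv.
by rewrite !subnK // ?leq_subRL // ?(leq_trans _ le7).
Qed.
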